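(* Let $q\in(0,1]$. The $q$-reflecting orthogonal planar motion $\{(X_q(t),Y_q(t))\}_{t\ge0}$ with speed $c>0$ and rate function $\lambda(t)\in C^2\bigl((0,\infty),[0,\infty)\bigr)$ is equal in distribution to a reflecting orthogonal planar random motion with speed $c$ and rate function $q\lambda(t)$.
   Context: Directions: $d_k=(\cos(k\pi/2),\sin(k\pi/2))$, $k=0,1,2,3$, with indices taken modulo 4. The reflecting orthogonal planar random motion with speed $c$ and rate function $\mu(t)$ is the position of a particle that starts at the origin at time $0$ with initial direction uniformly distributed on $\{d_0,d_1,d_2,d_3\}$, moves with velocity $c\,d_k$ as long as its current direction is $d_k$, and at each event of a non-homogeneous Poisson process with rate function $\mu(t)$ switches from its current direction to one of the other three directions, each with probability $1/3$ (independently of everything else). The $q$-reflecting orthogonal planar motion with rate function $\lambda(t)$ (reflecting orthogonal motion with Bernoulli trials) is defined in the same way, with Poisson rate function $\lambda(t)$, except that at each Poisson event the particle keeps its current direction with probability $1-q$ and switches to each of the other three directions with probability $q/3$. *)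

(* Defs.v *)
From HB Require Import structures.
From mathcomp Require Import all_boot all_order all_algebra.
From mathcomp Require Import all_classical all_reals all_analysis.
Set Implicit Arguments.
Unset Strict Implicit.
Unset Printing Implicit Defensive.
Import Order.TTheory GRing.Theory Num.Theory.
Import numFieldNormedType.Exports.
Local Open Scope classical_set_scope.
Local Open Scope ring_scope.

Definition C2_on_pos (R : realType) (f : R -> R) : Prop :=
  forall t : R, 0 < t ->
    [/\ derivable f t 1, derivable f^`()%classic t 1
      & {for t, continuous f^`(2)%classic}].

(* The sigma-algebra on W generated by the X i, i in D, where G is the
   sigma-algebra of the state space. *)
Definition process_sigma (I W T : Type) (D : set I) (G : set (set T))
    (X : I -> W -> T) : set (set W) :=
  <<s \bigcup_(i in D) preimage_set_system setT (X i) G >>.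

Definition independent_systems d (W : measurableType d) (R : realType)
    (P : probability W R) (F G : set (set W)) : Prop :=
  forall A B, F A -> G B -> P (A `&` B) = (P A * P B)%E.

Definition mutually_independent d (W : measurableType d) (R : realType)
    (P : probability W R) d' (T : measurableType d') (I : finType)
    (X : I -> W -> T) : Prop :=
  forall (J : {set I}) (B : I -> set T), (forall i, measurable (B i)) ->
    P (\bigcap_(i in [set` J]) (X i @^-1` B i)) =
    (\prod_(i in J) P (X i @^-1` B i))%E.

(* Non-homogeneous Poisson process on [0, +oo[ with rate function rate,
   represented by its counting process: N t w is the number of events in
   ]0, t].  Only the values N t with 0 <= t, and rate s with 0 < s, matter. *)
Record poisson_process d (W : measurableType d) (R : realType)
    (P : probability W R) (rate : R -> R) (N : R -> W -> nat) : Prop := {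
  poisson_meas : forall t : R, 0 <= t -> measurable_fun setT (N t) ;
  poisson_start : forall w, N 0 w = 0%N ;
  poisson_nondecreasing : forall w (s t : R), 0 <= s -> s <= t ->
    (N s w <= N t w)%N ;
  poisson_right_cont : forall w (t : R), 0 <= t ->
    \forall u \near t^'+, N u w = N t w ;
  (* Without local integrability up to 0 no such process exists; the clause
     is needed because Rintegral returns 0 on an infinite integral. *)
  poisson_rate_integrable : forall t : R, 0 <= t ->
    lebesgue_measure.-integrable `]0, t] (EFin \o rate) ;
  poisson_indep_increments : forall (n : nat) (t : nat -> R), 0 <= t 0%N ->
    (forall i, t i <= t i.+1) ->
    mutually_independent P
      (fun (i : 'I_n) (w : W) => (N (t i.+1) w - N (t i) w)%N) ;
  (* The second argument of poisson_prob is a dummy. *)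
  poisson_increments : forall (s t : R) (U : set nat), 0 <= s -> s <= t ->
    P [set w | U (N t w - N s w)%N] =
    poisson_prob (\int[lebesgue_measure]_(u in `]s, t]) rate u) 0%N U }.

Record markov_directions d (W : measurableType d) (R : realType)
    (P : probability W R) (K : 'I_4 -> 'I_4 -> R) (D : nat -> W -> 'I_4) :
    Prop := {
  directions_meas : forall n k, measurable (D n @^-1` [set k]) ;
  directions_init : forall k, P (D 0%N @^-1` [set k]) = (4^-1)%:E ;
  directions_step : forall (n : nat) (k : nat -> 'I_4),
    P [set w | forall i, (i <= n.+1)%N -> D i w = k i] =
    (P [set w | forall i, (i <= n)%N -> D i w = k i]
      * (K (k n) (k n.+1))%:E)%E }.

Definition direction (R : realType) (k : 'I_4) : R * R :=
  (cos (k%:R * pi / 2), sin (k%:R * pi / 2)).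

(* Planar motion with speed c: D n is the direction chosen at the n-th event
   of the Poisson process N (D 0 being the initial direction), so that the
   current direction at time s is D (N s w) w. *)
Definition orthogonal_motion d (W : measurableType d) (R : realType)
    (P : probability W R) (K : 'I_4 -> 'I_4 -> R) (c : R) (rate : R -> R)
    (XY : R -> W -> R * R) : Prop :=
  exists (N : R -> W -> nat) (D : nat -> W -> 'I_4),
    [/\ poisson_process P rate N,
        markov_directions P K D,
        independent_systems P
          (process_sigma [set t : R | 0 <= t] [set: set nat] N)
          (process_sigma [set: nat] [set: set 'I_4] D) &
        forall (t : R) w, 0 <= t ->
          XY t w =
          (\int[lebesgue_measure]_(s in `[0, t])
              (c * (direction R (D (N s w) w)).1),
           \int[lebesgue_measure]_(s in `[0, t])
              (c * (direction R (D (N s w) w)).2))].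

Definition reflecting_kernel (R : realType) (i j : 'I_4) : R :=
  if i == j then 0 else 3^-1.

Definition q_reflecting_kernel (R : realType) (q : R) (i j : 'I_4) : R :=
  if i == j then 1 - q else q / 3.

Definition reflecting_motion d (W : measurableType d) (R : realType)
    (P : probability W R) (c : R) (rate : R -> R) (XY : R -> W -> R * R) :
    Prop :=
  orthogonal_motion P (@reflecting_kernel R) c rate XY.

Definition q_reflecting_motion d (W : measurableType d) (R : realType)
    (P : probability W R) (q c : R) (rate : R -> R)
    (XY : R -> W -> R * R) : Prop :=
  orthogonal_motion P (q_reflecting_kernel q) c rate XY.

(* Equality of the laws, on the path space (R^2)^[0, +oo[ with its product
   sigma-algebra, of two planar processes defined on possibly different
   probability spaces. *)
Definition equal_in_distribution (R : realType)
    d1 (W1 : measurableType d1) (P1 : probability W1 R)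
    d2 (W2 : measurableType d2) (P2 : probability W2 R)
    (XY1 : R -> W1 -> R * R) (XY2 : R -> W2 -> R * R) : Prop :=
  forall A : set (R -> R * R),
    process_sigma [set t : R | 0 <= t]
      (measurable : set (set (measurableTypeR R * measurableTypeR R)))
      (fun t (path : R -> R * R) => path t) A ->
    P1 [set w | A (XY1 ^~ w)] = P2 [set w | A (XY2 ^~ w)].

(* Main.v *)
Require Import Defs.
From HB Require Import structures.
From mathcomp Require Import all_boot all_order all_algebra.
From mathcomp Require Import all_classical all_reals all_analysis.
From mathcomp Require Import measurable_realfun ring zify.
Import Order.TTheory GRing.Theory Num.Theory.
Import numFieldNormedType.Exports.
Local Open Scope classical_set_scope.
Local Open Scope ring_scope.
Set Implicit Arguments.
Unset Strict Implicit.
Unset Printing Implicit Defensive.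

(** Both motions are functionals of their direction process
    V t = D (N t), so it is enough that the two direction processes have the
    same law.

    A kernel on four states that treats all changes of direction alike is
    k a i j = (1 + (4 [i = j] - 1) a) / 4, where a is its eigenvalue on the
    vectors of sum 0 ([symmetric_kernel]).  These kernels multiply like their
    eigenvalues.  Hence, if r is the mean number of Poisson events in ]s, t],
    averaging the powers of k a over that number gives k (exp (r (a - 1))).
    By the independence of Poisson increments and the Markov property of the
    directions, V is a Markov process with these transitions, started
    uniformly ([direction_markov], [direction_initial]): its
    finite-dimensional laws depend on a and on the rate only through
    r (a - 1).  For the q-reflecting motion a = 1 - 4 q / 3 and r is the
    integral of lambda; for the reflecting motion with rate q lambda,
    a = 1 - 4 / 3 and r is q times that integral.  In both cases
    r (a - 1) = - 4 / 3 * q * (integral of lambda): thinning the events of a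
    Poisson process by q has the same effect as multiplying its rate by q.

    It remains to go from finite-dimensional laws to laws of positions.  A
    pi-lambda argument extends the equality to all events of the direction
    process ([sigma_finite_time_event_same_law]).  Since the paths of V are
    right-continuous step functions, the position is a limit of Riemann sums
    ([riemann_sum_cvg]), hence a measurable functional of the path of V
    ([motion_functional_event]). *)

(** * Partitioning events along a countable random variable *)

Definition discrete_rv d (W : measurableType d) (T : countType) (f : W -> T) :=
  forall S : set T, measurable (f @^-1` S).

(** Every subset of a countable type is a countable union of points, so only
    the points have to be tested. *)
Lemma discrete_rv_fibers d (W : measurableType d) (T : countType)
    (f : W -> T) :
  (forall x, measurable (f @^-1` [set x])) -> discrete_rv f.
Proof.
move=> mf S.
have -> : f @^-1` S = \bigcup_(n in [set n | exists2 x, S x & pickle x = n])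
    (if @pickle_inv T n is Some x then f @^-1` [set x] else set0).
  apply/seteqP; split => w /=.
    by move=> Sw; exists (pickle (f w)); [exists (f w) | rewrite pickleK_inv].
  by move=> [_ [x Sx <-]]; rewrite pickleK_inv /= => ->.
apply: bigcup_measurable => n [x Sx <-]; rewrite pickleK_inv; exact: mf.
Qed.

Lemma discrete_rv_comp d (W : measurableType d) (T U : countType)
    (f : W -> T) (h : T -> U) :
  discrete_rv f -> discrete_rv (h \o f).
Proof. by move=> mf S; exact: (mf (h @^-1` S)). Qed.

(** This makes the current direction D (N t), a sequence of random variables
    read at a random index, a random variable. *)
Lemma discrete_rv_bind d (W : measurableType d) (T U : countType)
    (f : W -> T) (g : T -> W -> U) :
  discrete_rv f -> (forall x, discrete_rv (g x)) ->
  discrete_rv (fun w => g (f w) w).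
Proof.
move=> mf mg; apply: discrete_rv_fibers => y.
suff mfg : discrete_rv (fun w => (f w, g (f w) w)).
  exact: (mfg [set z | z.2 = y]).
apply: discrete_rv_fibers => -[x z].
rewrite (_ : _ @^-1` _ = f @^-1` [set x] `&` g x @^-1` [set z]).
  by apply: measurableI; [exact: mf | exact: mg].
by apply/seteqP; split => w /= [] -> ->.
Qed.

Lemma discrete_rv_map d (W : measurableType d) (I : Type) (T : countType)
    (X : I -> W -> T) (s : seq I) :
  (forall i, discrete_rv (X i)) -> discrete_rv (fun w => [seq X i w | i <- s]).
Proof.
move=> mX; elim: s => [|i s IH] /=.
  move=> S; rewrite /preimage; have [S0|S0] := pselect (S [::]).
    by rewrite (_ : mkset _ = setT)//; apply/seteqP; split => w // _; exact: S0.
  by rewrite (_ : mkset _ = set0)//; apply/seteqP; split => // w /S0.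
exact: (discrete_rv_bind (g := fun l w => X i w :: l) IH
  (fun l => discrete_rv_comp (fun y => y :: l) (mX i))).
Qed.

Section fibers.
Local Open Scope ereal_scope.

(** Countable additivity over the fibres of f, which are listed by their codes;
    codes of no value contribute 0. *)
Lemma measure_fibers d (W : measurableType d) (R : realType)
    (mu : probability W R) (T : countType) (f : W -> T) (E : set W) :
  discrete_rv f -> measurable E ->
  mu E = \sum_(n <oo)
    (if @pickle_inv T n is Some x then mu (E `&` f @^-1` [set x]) else 0).
Proof.
move=> mf mE.
pose F n := if @pickle_inv T n is Some x then E `&` f @^-1` [set x] else set0.
have mF n : measurable (F n).
  rewrite /F; case: pickle_inv => // x; apply: measurableI => //; exact: mf.
have EF : E = \bigcup_n F n.
  apply/seteqP; split => w.
    by move=> Ew; exists (pickle (f w)) => //; rewrite /F pickleK_inv.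
  by move=> [n _]; rewrite /F; case: pickle_inv => // x [].
rewrite {1}EF measure_semi_bigcup//.
- by apply: eq_eseriesr => n _; rewrite /F; case: pickle_inv.
- apply/trivIsetP => i j _ _ ij; apply/seteqP; split => // w [].
  rewrite /F; case E1 : (@pickle_inv T i) => [x|] //.
  case E2 : (@pickle_inv T j) => [y|] // [_ /= fx] [_ /= fy].
  move/eqP: ij; apply.
  have := @pickle_invK T i; have := @pickle_invK T j.
  by rewrite E1 E2 /= -fx -fy => -> ->.
- exact: bigcup_measurable.
Qed.

Lemma measure_nat_fibers d (W : measurableType d) (R : realType)
    (mu : probability W R) (f : W -> nat) (E : set W) :
  discrete_rv f -> measurable E ->
  mu E = \sum_(n <oo) mu (E `&` f @^-1` [set n]).
Proof.
move=> mf mE; rewrite (measure_fibers mu mf mE); apply: eq_eseriesr => n _.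
by have -> : @pickle_inv nat n = Some n by exact: (@pickleK_inv _ n).
Qed.

Lemma measure_ord_fibers d (W : measurableType d) (R : realType)
    (mu : probability W R) n (f : W -> 'I_n) (E : set W) :
  discrete_rv f -> measurable E ->
  mu E = \sum_(i < n) mu (E `&` f @^-1` [set i]).
Proof.
move=> mf mE; rewrite -measure_bigsetU_ord.
- congr (mu _); rewrite -bigcup_seq; apply/seteqP; split => w /=.
    by move=> Ew; exists (f w) => //=; rewrite mem_index_enum.
  by move=> [i _ []].
- by move=> i; apply: measurableI => //; exact: mf.
- apply/trivIsetP => i j _ _ /eqP ij.
  apply/seteqP; split => // w [[_ /= fi] [_ /= fj]].
  by apply: ij; rewrite -fi -fj.
Qed.

(** Conditioning on a countable random variable: an identity between
    probabilities may be checked after fixing the value of f1 and f2.  The two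
    events may live on different spaces (comparison of laws), and the factor a
    allows for transition probabilities (Markov properties). *)
Lemma eq_measure_fibers d1 (W1 : measurableType d1) d2 (W2 : measurableType d2)
    (R : realType) (mu1 : probability W1 R)
    (mu2 : probability W2 R) (T : countType)
    (f1 : W1 -> T) (f2 : W2 -> T) (E1 : set W1) (E2 : set W2) (a : R) :
  discrete_rv f1 -> discrete_rv f2 -> measurable E1 -> measurable E2 ->
  (forall x, mu1 (E1 `&` f1 @^-1` [set x]) =
             a%:E * mu2 (E2 `&` f2 @^-1` [set x])) ->
  mu1 E1 = a%:E * mu2 E2.
Proof.
move=> mf1 mf2 mE1 mE2 E12.
rewrite (measure_fibers mu1 mf1 mE1) (measure_fibers mu2 mf2 mE2).
rewrite -nneseriesZl; last by move=> n _; case: pickle_inv.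
by apply: eq_eseriesr => n _; case: pickle_inv => [x|]; rewrite ?mule0.
Qed.

End fibers.

Lemma process_sigma_preimage (I W T : Type) (D : set I) (G : set (set T))
    (X : I -> W -> T) i B :
  D i -> G B -> process_sigma D G X (X i @^-1` B).
Proof.
move=> Di GB; apply: sub_sigma_algebra; exists i => //.
by exists B; rewrite // setTI.
Qed.

Lemma sigma_algebra_setI (W : Type) (G : set (set W)) : setI_closed <<s G >>.
Proof.
by have /sigma_algebraP[] := @smallest_sigma_algebra W setT G.
Qed.

Lemma process_sigma_fin_fibers (I W T : Type) (D : set I)
    (X : I -> W -> T) (t : nat -> I) (x : nat -> T) m :
  (forall n, D (t n)) ->
  process_sigma D [set: set T] X
    [set w | forall n, (n <= m)%N -> X (t n) w = x n].
Proof.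
move=> Dt; elim: m => [|m IH].
  rewrite (_ : mkset _ = X (t 0%N) @^-1` [set x 0%N]).
    exact: process_sigma_preimage.
  by apply/seteqP; split => w /= => [->//|Xw n]; rewrite leqn0 => /eqP ->.
rewrite (_ : mkset _ = [set w | forall n, (n <= m)%N -> X (t n) w = x n] `&`
   X (t m.+1) @^-1` [set x m.+1]).
  by apply: sigma_algebra_setI => //; exact: process_sigma_preimage.
apply/seteqP; split => w /=.
  by move=> Xw; split => [n nm|]; apply: Xw => //; exact: leqW.
by move=> [Xw Xm] n; rewrite leq_eqVlt => /predU1P[->//|]; exact: Xw.
Qed.

Lemma eq_map_iota (T : eqType) (f g : nat -> T) m :
  [seq f i | i <- iota 0 m.+1] = [seq g i | i <- iota 0 m.+1] <->
  forall i, (i <= m)%N -> f i = g i.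
Proof.
split=> [/eq_in_map fg i im|fg].
  by apply: fg; rewrite mem_iota add0n ltnS.
by apply/eq_in_map => i; rewrite mem_iota add0n ltnS => /andP[_]; exact: fg.
Qed.

Lemma measurable_fin_fibers d (W : measurableType d) (T : countType)
    (X : nat -> W -> T) (x : nat -> T) m :
  (forall i, discrete_rv (X i)) ->
  measurable [set w | forall i, (i <= m)%N -> X i w = x i].
Proof.
move=> mX.
have := discrete_rv_map (iota 0 m.+1) mX [set [seq x i | i <- iota 0 m.+1]].
by congr measurable; apply/seteqP; split => w /= /eq_map_iota.
Qed.

(** * The chain of directions *)

(** The kernel on four states that is invariant under all permutations of the
    states and has eigenvalues 1 (constants) and a (vectors of sum 0). *)
Definition symmetric_kernel (R : realType) (a : R) (i j : 'I_4) : R :=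
  4^-1 * (1 + (4 * (i == j)%:R - 1) * a).

Lemma symmetric_kernel1 (R : realType) (i j : 'I_4) :
  symmetric_kernel (1 : R) i j = (i == j)%:R.
Proof. by rewrite /symmetric_kernel; case: (i == j); field. Qed.

Lemma symmetric_kernelM (R : realType) (a b : R) (i k : 'I_4) :
  \sum_(j < 4) symmetric_kernel a i j * symmetric_kernel b j k =
  symmetric_kernel (a * b) i k.
Proof.
rewrite /symmetric_kernel !big_ord_recl big_ord0.
case: i => -[|[|[|[|//]]]] hi; case: k => -[|[|[|[|//]]]] hk;
  rewrite !eqE /= ?mulr1n ?mulr0n; by field.
Qed.

Lemma q_reflecting_kernelE (R : realType) (q : R) (i j : 'I_4) :
  q_reflecting_kernel q i j = symmetric_kernel (1 - 4 / 3 * q) i j.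
Proof.
by rewrite /q_reflecting_kernel /symmetric_kernel; case: (i == j) => /=; field.
Qed.

Section chain.
Context d (W : measurableType d) (R : realType) (P : probability W R)
  (a : R) (D : nat -> W -> 'I_4).
Hypothesis HD : markov_directions P (symmetric_kernel a) D.

Lemma directions_discrete n : discrete_rv (D n).
Proof. by apply: discrete_rv_fibers => k; exact: directions_meas HD n k. Qed.

(** [directions_step] is the case where E fixes the whole past.  An event that
    depends on D 0, ..., D n only is a union of such events. *)
Lemma markov_property n (E : set W) i j : measurable E ->
  (forall w w', (forall m, (m <= n)%N -> D m w = D m w') -> E w -> E w') ->
  (P (E `&` D n @^-1` [set i] `&` D n.+1 @^-1` [set j]) =
   (symmetric_kernel a i j)%:E * P (E `&` D n @^-1` [set i]))%E.
Proof.
move=> mE detE.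
have mDn : discrete_rv (fun w => [seq D m w | m <- iota 0 n.+1]).
  exact: discrete_rv_map directions_discrete.
have m1 : measurable (E `&` D n @^-1` [set i]).
  by apply: measurableI => //; exact: directions_discrete.
have m2 : measurable (E `&` D n @^-1` [set i] `&` D n.+1 @^-1` [set j]).
  by apply: measurableI => //; exact: directions_discrete.
apply: (eq_measure_fibers mDn mDn m2 m1) => x.
have [[w0 [[Ew0 Dw0] fw0]]|none] := pselect (exists w0,
    (E `&` D n @^-1` [set i]) w0 /\ [seq D m w0 | m <- iota 0 n.+1] = x).
  have eqD w : [seq D m w | m <- iota 0 n.+1] = x <->
      forall m, (m <= n)%N -> D m w = D m w0.
    by rewrite -fw0; exact: eq_map_iota.
  pose k m := if (m <= n)%N then D m w0 else j.
  rewrite [X in _ = (_ * P X)%E](_ : _ =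
      [set w | forall m, (m <= n)%N -> D m w = k m]).
    rewrite [X in P X = _](_ : _ =
        [set w | forall m, (m <= n.+1)%N -> D m w = k m]).
      rewrite (directions_step HD) muleC; congr (_%:E * _)%E.
      by rewrite /k leqnn ltnn Dw0.
    apply/seteqP; split => w.
      move=> [[[Ew Dw] Dw'] /eqD Dww0] m; rewrite leq_eqVlt => /predU1P[->|mn].
        by rewrite /k ltnn.
      by rewrite /k -ltnS mn; exact: Dww0.
    move=> /= Dw.
    have Dww0 m : (m <= n)%N -> D m w = D m w0.
      by move=> mn; rewrite Dw ?leqW// /k mn.
    split; last by apply/eqD.
    split; last by rewrite /= Dw// /k ltnn.
    split; last by rewrite /= Dww0.
    by apply: detE Ew0 => m mn; rewrite Dww0.
  apply/seteqP; split => w.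
    by move=> [[Ew Dw] /eqD Dww0] m mn; rewrite /k mn Dww0.
  move=> /= Dw.
  have Dww0 m : (m <= n)%N -> D m w = D m w0 by move=> mn; rewrite Dw// /k mn.
  split; last by apply/eqD.
  split; last by rewrite /= Dww0.
  by apply: detE Ew0 => m mn; rewrite Dww0.
rewrite [X in P X = _](_ : _ = set0) ?[X in _ = (_ * P X)%E](_ : _ = set0).
- by rewrite measure0 mule0.
- by apply/seteqP; split => // w [Ew fw]; apply: none; exists w.
- by apply/seteqP; split => // w [[Ew _] fw]; apply: none; exists w.
Qed.

(** Chapman-Kolmogorov: the l-step kernel is the l-th power, that is, the
    symmetric kernel of eigenvalue a ^+ l. *)
Lemma markov_property_iter n l (E : set W) i j : measurable E ->
  (forall w w', (forall m, (m <= n)%N -> D m w = D m w') -> E w -> E w') ->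
  (P (E `&` D n @^-1` [set i] `&` D (n + l)%N @^-1` [set j]) =
   (symmetric_kernel (a ^+ l) i j)%:E * P (E `&` D n @^-1` [set i]))%E.
Proof.
move=> mE detE; have mD := directions_discrete.
have m1 : measurable (E `&` D n @^-1` [set i]).
  by apply: measurableI => //; exact: mD.
elim: l j => [|l IH] j.
  rewrite addn0 expr0 symmetric_kernel1; have [->|ij] := eqVneq i j.
    by rewrite mul1e -setIA setIid.
  rewrite mul0e (_ : _ `&` _ = set0) ?measure0//.
  by apply/seteqP; split => // w [[_ /= ->] /= ji]; rewrite ji eqxx in ij.
rewrite (@measure_ord_fibers _ _ _ _ _ _ _ (mD (n + l)%N)); last first.
  by apply: measurableI => //; exact: mD.
under eq_bigr => k _.
  rewrite setIAC addnS markov_property; first last.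
  - move=> w w' ww' [Ew Dw]; split.
      by apply: detE Ew => m mn; apply: ww'; rewrite (leq_trans mn)// leq_addr.
    by rewrite /= -ww'// leq_addr.
  - exact: m1.
  rewrite IH muleA -EFinM mulrC. over.
rewrite -(fineK (fin_num_measure P _ m1)).
under eq_bigr do rewrite -EFinM.
by rewrite sumEFin -mulr_suml exprSr -symmetric_kernelM EFinM.
Qed.
End chain.

(** * The direction process *)

Lemma poisson_prob_set1 (R : realType) (r : R) n : 0 <= r ->
  poisson_prob r 0 [set n] = (expR (- r) * exp_coeff r n)%:E.
Proof.
rewrite le_eqVlt /poisson_prob /exp_coeff /= => /predU1P[<-|r0].
  rewrite ltxx oppr0 expR0 mul1r diracE; congr EFin.
  case: n => [|n]; first by rewrite mem_set//= expr0 fact0 divr1.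
  by rewrite memNset//= expr0n/= mul0r.
by rewrite r0 esum_set1 ?lee_fin ?poisson_pmf_ge0// /poisson_pmf r0 mulrC.
Qed.

(** The generating function of the Poisson law, E (a ^ N) = exp (r (a - 1)),
    applied to the two eigenvalues 1 and a.  The factor p stands for the
    probability of the past; it is kept inside the series because the terms
    may have either sign, so that extended-real series do not factor. *)
Lemma poisson_average_symmetric_kernel (R : realType) (r a p : R) i j :
  (\sum_(n <oo)
     (expR (- r) * exp_coeff r n * symmetric_kernel (a ^+ n) i j * p)%:E)%E =
  (symmetric_kernel (expR (r * (a - 1))) i j * p)%:E.
Proof.
pose e : R := 4 * (i == j)%:R - 1; pose b := expR (- r) * 4^-1 * p.
rewrite (_ : (fun n => _) = EFin \o
  (fun n => b * (series (exp_coeff r) n + e * series (exp_coeff (r * a)) n))).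
  apply: cvg_lim => //; apply: cvg_EFin; first exact: nearW.
  rewrite (_ : symmetric_kernel _ _ _ * p = b * (expR r + e * expR (r * a))).
    apply: cvgM; first exact: cvg_cst.
    apply: cvgD; first exact: is_cvg_series_exp_coeff.
    by apply: cvgM; [exact: cvg_cst | exact: is_cvg_series_exp_coeff].
  rewrite /symmetric_kernel -/e /b mulrBr mulr1 addrC expRD.
  transitivity
    (4^-1 * p * (expR (- r) * expR r + e * (expR (- r) * expR (r * a)))).
    by rewrite expRN mulVf ?gt_eqF ?expR_gt0//; ring.
  by ring.
apply/funext => n /=; rewrite sumEFin; congr EFin.
rewrite /series /= !mulr_sumr -big_split /= mulr_sumr; apply: eq_bigr => l _.
by rewrite /symmetric_kernel -/e /b /exp_coeff /= exprMn; ring.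
Qed.

Section directions_process.
Context d (W : measurableType d) (R : realType) (P : probability W R)
  (a : R) (rate : R -> R) (N : R -> W -> nat) (D : nat -> W -> 'I_4).
Hypothesis rate_ge0 : forall t, 0 < t -> 0 <= rate t.
Hypothesis HN : poisson_process P rate N.
Hypothesis HD : markov_directions P (symmetric_kernel a) D.
Hypothesis HI : independent_systems P
  (process_sigma [set t : R | 0 <= t] [set: set nat] N)
  (process_sigma [set: nat] [set: set 'I_4] D).

Lemma poisson_discrete t : 0 <= t -> discrete_rv (N t).
Proof.
by move=> t0 S; rewrite -[X in measurable X]setTI; exact: (poisson_meas HN t0).
Qed.

Lemma current_direction_discrete t :
  0 <= t -> discrete_rv (fun w => D (N t w) w).
Proof.
move=> t0; apply: discrete_rv_bind; first exact: poisson_discrete.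
exact: directions_discrete HD.
Qed.

Section times.
Variable t : nat -> R.
Hypothesis t0 : t 0%N = 0.
Hypothesis tS : forall i, t i <= t i.+1.

Lemma times_ge0 i : 0 <= t i.
Proof. by elim: i => [|i IH]; [rewrite t0 | exact: le_trans (tS i)]. Qed.

(** The counting process starts at 0 and does not decrease, so truncated
    subtraction loses nothing and the increments give back the counts. *)
Lemma counts_of_increments (x : nat -> nat) m w : x 0%N = 0%N ->
  (forall i, (i < m)%N -> (x i <= x i.+1)%N) ->
  (forall i, (i < m)%N -> (N (t i.+1) w - N (t i) w = x i.+1 - x i)%N) <->
  (forall i, (i <= m)%N -> N (t i) w = x i).
Proof.
move=> x0 xS; split=> [Nx i|Nx i im]; last by rewrite !Nx// ltnW.
elim: i => [_|i IH im]; first by rewrite t0 x0 (poisson_start HN).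
have := Nx _ im; have := xS _ im.
have := poisson_nondecreasing HN w (times_ge0 i) (tS i).
by rewrite (IH (ltnW im)); lia.
Qed.

(** The counts at times t 0, ..., t m are functions of the first m increments,
    which are independent of the next one. *)
Lemma poisson_markov (x : nat -> nat) m : x 0%N = 0%N ->
  (forall i, (i <= m)%N -> (x i <= x i.+1)%N) ->
  P [set w | forall i, (i <= m.+1)%N -> N (t i) w = x i] =
  (poisson_prob (\int[lebesgue_measure]_(u in `]t m, t m.+1]) rate u) 0%N
     [set (x m.+1 - x m)%N] *
   P [set w | forall i, (i <= m)%N -> N (t i) w = x i])%E.
Proof.
move=> x0 xS.
have ti0 : 0 <= t 0%N by rewrite t0.
have indep J := poisson_indep_increments HN ti0 tS
  (n := m.+1) J (B := fun i => [set (x i.+1 - x i)%N]) (fun i => I).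
have := indep [set: 'I_m.+1]%SET; have := indep [set~ ord_max]%SET.
rewrite (_ : \bigcap_(i in _) _ =
  [set w | forall i, (i <= m)%N -> N (t i) w = x i]); last first.
  apply/seteqP; split => w /=.
    move=> Nx; apply/counts_of_increments => // i im; first exact/xS/ltnW.
    have im1 : (i < m.+1)%N by exact: leqW.
    by apply: (Nx (Ordinal im1)); rewrite /= !inE -val_eqE /= neq_ltn im.
  move=> Nx i /=; rewrite !inE -val_eqE /= => im.
  by rewrite !Nx//; have := ltn_ord i; lia.
move=> ->.
rewrite (_ : \bigcap_(i in _) _ =
  [set w | forall i, (i <= m.+1)%N -> N (t i) w = x i]); last first.
  apply/seteqP; split => w /=.
    move=> Nx; apply/counts_of_increments => // i im.
    by apply: (Nx (Ordinal im)); rewrite /= inE.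
  by move=> Nx i _; rewrite /= !Nx//; have := ltn_ord i; lia.
move=> ->; rewrite (bigD1 ord_max) ?inE//=; apply: (f_equal2 mule).
  exact: (poisson_increments HN [set (x m.+1 - x m)%N] (times_ge0 m) (tS m)).
by apply: eq_bigl => i; rewrite !inE.
Qed.


(** The current direction is a Markov process.  Given the counts x 0, ..., x m
    at the times t 0, ..., t m, the past of the process is an event about
    D (x 0), ..., D (x m).  If l events occur in the next interval, the
    direction moves by the l-th power of the kernel; l has a Poisson law and is
    independent of the past, so the kernel is averaged over it. *)
Lemma direction_markov (k : nat -> 'I_4) m :
  P [set w | forall i, (i <= m.+1)%N -> D (N (t i) w) w = k i] =
  ((symmetric_kernel
      (expR ((\int[lebesgue_measure]_(u in `]t m, t m.+1]) rate u) * (a - 1)))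
      (k m) (k m.+1))%:E *
   P [set w | forall i, (i <= m)%N -> D (N (t i) w) w = k i])%E.
Proof.
set r := (\int[_]_(_ in _) _)%R.
have r0 : 0 <= r.
  apply: Rintegral_ge0 => u /=; rewrite in_itv /= => /andP[tu _].
  exact: rate_ge0 (le_lt_trans (times_ge0 m) tu).
pose f w := [seq N (t i) w | i <- iota 0 m.+1].
have mf : discrete_rv f.
  by apply: discrete_rv_map => i; apply: poisson_discrete; exact: times_ge0.
have mV n : measurable [set w | forall i, (i <= n)%N -> D (N (t i) w) w = k i].
  apply: measurable_fin_fibers => i.
  by apply: current_direction_discrete; exact: times_ge0.
apply: (eq_measure_fibers mf mf (mV m.+1) (mV m)) => n.
have [[w0 fw0]|none] := pselect (exists w0, f w0 = n); last first.
  rewrite [X in P X = _](_ : _ = set0) ?[X in _ = (_ * P X)%E](_ : _ = set0).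
  - by rewrite measure0 mule0.
  - by apply/seteqP; split => // w [_ fw]; apply: none; exists w.
  - by apply/seteqP; split => // w [_ fw]; apply: none; exists w.
pose x i := N (t i) w0.
have eqN w : f w = n <-> forall i, (i <= m)%N -> N (t i) w = x i.
  by rewrite -fw0; exact: eq_map_iota.
have xS i : (x i <= x i.+1)%N.
  exact: (poisson_nondecreasing HN w0 (times_ge0 i) (tS i)).
have x_mono : {homo x : i j / (i <= j)%N}.
  by apply: homo_leq => //; exact: leq_trans.
(* The counts up to time t m.+1 when l events occur in the last interval. *)
pose y l i := if (i <= m)%N then x i else (x m + l)%N.
pose A := [set w | forall i, (i <= m)%N -> N (t i) w = x i].
pose A' l := [set w | forall i, (i <= m.+1)%N -> N (t i) w = y l i].
pose B := [set w | forall i, (i <= m)%N -> D (x i) w = k i].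
pose C l := D (x m + l)%N @^-1` [set k m.+1].
have sB : process_sigma [set: nat] [set: set 'I_4] D B.
  by apply: (process_sigma_fin_fibers (X := D)).
have sC l : process_sigma [set: nat] [set: set 'I_4] D (C l).
  exact: process_sigma_preimage.
have PAB : P (A `&` B) = (P A * P B)%E.
  by apply: HI => //; apply: process_sigma_fin_fibers => i; exact: times_ge0.
have PA'BC l : P (A' l `&` (B `&` C l)) = (P (A' l) * P (B `&` C l))%E.
  apply: HI; first by apply: process_sigma_fin_fibers => i; exact: times_ge0.
  by apply: sigma_algebra_setI; [exact: sB | exact: sC].
have PA' l : P (A' l) = ((expR (- r) * exp_coeff r l)%:E * P A)%E.
  rewrite /A' poisson_markov.
  - rewrite /y ltnn leqnn addKn poisson_prob_set1//; congr (_ * P _)%E.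
    by apply/seteqP; split => w /= Nw i im; rewrite Nw// im.
  - by rewrite /y /= /x t0 (poisson_start HN).
  - move=> i im; rewrite /y im; case: ifPn => // im'.
    by rewrite (_ : i = m) ?leq_addr//; lia.
have mB : measurable B.
  by apply: measurable_fin_fibers => i; exact: (directions_discrete HD (x i)).
have PBC l : P (B `&` C l) =
    ((symmetric_kernel (a ^+ l) (k m) (k m.+1))%:E * P B)%E.
  have BD : B = B `&` D (x m) @^-1` [set k m].
    by apply/seteqP; split => [w Bw|w []//]; split => //; exact: Bw.
  rewrite BD (markov_property_iter HD)// => w w' ww' Bw i im.
  by rewrite -ww' ?x_mono//; exact: Bw.
have mA : measurable A.
  apply: measurable_fin_fibers => i.
  by apply: poisson_discrete; exact: times_ge0.
have -> : [set w | forall i, (i <= m)%N -> D (N (t i) w) w = k i] `&`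
    f @^-1` [set n] = A `&` B.
  apply/seteqP; split => w.
    move=> [Vk /eqN Aw]; split => // i im; rewrite -Aw//; exact: Vk.
  by move=> [Aw Bw]; split; [move=> i im; rewrite Aw//; exact: Bw | exact/eqN].
pose dN w := (N (t m.+1) w - N (t m) w)%N.
have mdN : discrete_rv dN.
  have mN i := poisson_discrete (times_ge0 i).
  apply: (discrete_rv_bind (g := fun j w => (N (t m.+1) w - j)%N)) => [|j].
    exact: mN.
  exact: (discrete_rv_comp (subn^~ j) (mN m.+1)).
rewrite (measure_nat_fibers P mdN); last first.
  by apply: measurableI; [exact: mV | exact: mf].
have [pA EA] : exists pA, P A = pA%:E.
  by exists (fine (P A)); rewrite fineK// fin_num_measure.
have [pB EB] : exists pB, P B = pB%:E.
  by exists (fine (P B)); rewrite fineK// fin_num_measure.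
(* Sum over the number l of events in the last interval. *)
rewrite PAB EA EB -!EFinM -poisson_average_symmetric_kernel.
apply: eq_eseriesr => l _; rewrite (_ : _ `&` _ = A' l `&` (B `&` C l)).
  by rewrite PA'BC PA' PBC EA EB -!EFinM; congr EFin; ring.
apply/seteqP; split => w.
  move=> [[Vk /eqN Aw] /= dNw].
  have Nm1 : N (t m.+1) w = (x m + l)%N.
    rewrite -dNw -(Aw m)// subnKC//.
    exact: (poisson_nondecreasing HN w (times_ge0 m) (tS m)).
  split; [|split].
  - move=> i; rewrite leq_eqVlt => /predU1P[->|im]; first by rewrite /y ltnn.
    by rewrite /y -ltnS im Aw.
  - by move=> i im; rewrite -Aw//; apply: Vk; exact: leqW.
  - by rewrite /C /= -Nm1; exact: Vk.
move=> [A'w [Bw Cw]].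
have Aw i : (i <= m)%N -> N (t i) w = x i.
  by move=> im; rewrite A'w ?leqW// /y im.
have Nm1 : N (t m.+1) w = (x m + l)%N by rewrite A'w// /y ltnn.
split; last by rewrite /= /dN Nm1 Aw// addKn.
split; last exact/eqN.
move=> i; rewrite leq_eqVlt => /predU1P[->|im]; first by rewrite Nm1.
by rewrite Aw//; exact: Bw.
Qed.

Lemma direction_initial (k : nat -> 'I_4) :
  P [set w | forall i, (i <= 0)%N -> D (N (t i) w) w = k i] = (4^-1)%:E.
Proof.
rewrite -(directions_init HD (k 0%N)); congr (P _).
apply/seteqP; split => w /= Dw.
  by rewrite -Dw// t0 (poisson_start HN).
by move=> i; rewrite leqn0 => /eqP ->; rewrite t0 (poisson_start HN).
Qed.

End times.
End directions_process.

(** * Laws of processes from finite-dimensional laws *)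

(** Cylinder events with an arbitrary base.  In this form, stability under
    intersection amounts to concatenating lists of times. *)
Definition finite_time_event (R : realType) (T : Type) : set (set (R -> T)) :=
  [set A | exists2 s : seq R, all (fun t => 0 <= t) s &
    forall v v' : R -> T, {in s, v =1 v'} -> A v -> A v'].

Lemma finite_time_event_setI (R : realType) (T : Type) :
  setI_closed (@finite_time_event R T).
Proof.
move=> A B [s s0 As] [s' s'0 Bs']; exists (s ++ s').
  by rewrite all_cat s0.
move=> v v' vv' [Av Bv]; split.
  by apply: As Av => t ts; apply: vv'; rewrite mem_cat ts.
by apply: Bs' Bv => t ts; apply: vv'; rewrite mem_cat ts orbT.
Qed.

Lemma finite_time_event_coordinate (R : realType) (T : Type) (t : R)
    (B : set T) :
  0 <= t -> finite_time_event [set v : R -> T | B (v t)].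
Proof.
move=> t0; exists [:: t]; first by rewrite /= t0.
by move=> v v' vv' /=; rewrite vv'// inE.
Qed.

(** Finite-dimensional laws are computed along nondecreasing sequences of times
    that start at 0; this puts any finite set of times into that form. *)
Lemma nondecreasing_enumeration (R : realType) (s : seq R) :
  all (fun t => 0 <= t) s ->
  exists (t : nat -> R) (m : nat), [/\ t 0%N = 0, forall i, t i <= t i.+1 &
    forall u, u \in s -> exists2 i, (i <= m)%N & t i = u].
Proof.
move=> s0; pose p := sort <=%R s; pose b := last 0 p.
have p0 : path <=%R 0 p.
  rewrite path_min_sorted ?sort_le_sorted//; apply/allP => u.
  by rewrite mem_sort => us; exact: (allP s0).
(* Past the last time b the sequence stays equal to b. *)
exists (nth b (0 :: p)), (size p); split => //.
- move=> i; have [ip|pi] := ltnP i (size p); first exact: (pathP b p0).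
  rewrite [X in _ <= X]nth_default//.
  move: pi; rewrite leq_eqVlt => /predU1P[<-|pi]; last by rewrite nth_default.
  by rewrite (nth_last b (0 :: p)).
- move=> u; rewrite -(mem_sort <=%R) -/p => up; exists (index u p).+1.
    by rewrite index_mem.
  by rewrite /= nth_index.
Qed.

Section law_determined_by_fdd.
Context (R : realType) (T : countType)
  d1 (W1 : measurableType d1) (P1 : probability W1 R) (V1 : R -> W1 -> T)
  d2 (W2 : measurableType d2) (P2 : probability W2 R) (V2 : R -> W2 -> T).
Hypothesis mV1 : forall t, 0 <= t -> discrete_rv (V1 t).
Hypothesis mV2 : forall t, 0 <= t -> discrete_rv (V2 t).
Hypothesis fdd : forall (t : nat -> R) (k : nat -> T) m, t 0%N = 0 ->
  (forall i, t i <= t i.+1) ->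
  P1 [set w | forall i, (i <= m)%N -> V1 (t i) w = k i] =
  P2 [set w | forall i, (i <= m)%N -> V2 (t i) w = k i].

Let same_law := [set A : set (R -> T) |
  [/\ measurable [set w | A (V1 ^~ w)], measurable [set w | A (V2 ^~ w)] &
      P1 [set w | A (V1 ^~ w)] = P2 [set w | A (V2 ^~ w)]]].

(** The path takes countably many patterns at the times of the event, and
    each pattern has the same probability for both processes. *)
Lemma finite_time_event_same_law : @finite_time_event R T `<=` same_law.
Proof.
move=> A [s s0 As]; have [t [m [t0 tS ts]]] := nondecreasing_enumeration s0.
have ti0 := times_ge0 t0 tS.
pose pat (v : R -> T) := [seq v (t i) | i <- iota 0 m.+1].
pose S := [set x | exists2 v, A v & pat v = x].
have AS v : A v <-> S (pat v).
  split=> [Av|[v' Av' /eq_map_iota vv']]; first by exists v.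
  by apply: As Av' => u /ts[i im <-]; exact: vv'.
have mf1 : discrete_rv (fun w => pat (V1 ^~ w)).
  by apply: (discrete_rv_map (X := fun i => V1 (t i))) => i; exact: mV1.
have mf2 : discrete_rv (fun w => pat (V2 ^~ w)).
  by apply: (discrete_rv_map (X := fun i => V2 (t i))) => i; exact: mV2.
have E1 : [set w | A (V1 ^~ w)] = (fun w => pat (V1 ^~ w)) @^-1` S.
  by apply/seteqP; split => w /AS.
have E2 : [set w | A (V2 ^~ w)] = (fun w => pat (V2 ^~ w)) @^-1` S.
  by apply/seteqP; split => w /AS.
rewrite /same_law /= E1 E2; split; [exact: mf1 | exact: mf2 |].
rewrite -[RHS]mul1e.
apply: (eq_measure_fibers mf1 mf2 (mf1 S) (mf2 S)) => x; rewrite mul1e.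
have [[v Av vx]|nSx] := pselect (S x); last first.
  rewrite [X in P1 X = _](_ : _ = set0) ?[X in _ = P2 X](_ : _ = set0).
  - by rewrite !measure0.
  - by apply/seteqP; split => // w [/= Sw fw]; apply: nSx; rewrite -fw.
  - by apply/seteqP; split => // w [/= Sw fw]; apply: nSx; rewrite -fw.
rewrite [X in P1 X = _](_ : _ =
    [set w | forall i, (i <= m)%N -> V1 (t i) w = v (t i)]).
  rewrite [X in _ = P2 X](_ : _ =
      [set w | forall i, (i <= m)%N -> V2 (t i) w = v (t i)]).
    exact: fdd.
  apply/seteqP; split => w /=; first by move=> [_]; rewrite -vx => /eq_map_iota.
  move=> /(eq_map_iota (fun i => V2 (t i) w)) Vv.
  by rewrite /pat Vv; split => //; exists v.
apply/seteqP; split => w /=; first by move=> [_]; rewrite -vx => /eq_map_iota.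
move=> /(eq_map_iota (fun i => V1 (t i) w)) Vv.
by rewrite /pat Vv; split => //; exists v.
Qed.

(** Dynkin's theorem: the finite-time events form a pi-system, and the events
    that have the same probability for both processes form a lambda-system. *)
Lemma sigma_finite_time_event_same_law :
  <<s @finite_time_event R T >> `<=` same_law.
Proof.
rewrite -setI_closed_g_dynkin_g_sigma_algebra; last first.
  exact: finite_time_event_setI.
apply: smallest_sub; last exact: finite_time_event_same_law.
split.
- split; [exact: measurableT | exact: measurableT |].
  exact: (eq_trans (probability_setT P1) (esym (probability_setT P2))).
- move=> A [mA1 mA2 PA].
  split; [exact: measurableC mA1 | exact: measurableC mA2 |].
  have := probability_setC P1 mA1; have := probability_setC P2 mA2.
  by rewrite -PA => <- ->.
- move=> F tF mF.
  have mF1 i : measurable [set w | F i (V1 ^~ w)] by have [] := mF i.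
  have mF2 i : measurable [set w | F i (V2 ^~ w)] by have [] := mF i.
  have mU1 : measurable (\bigcup_i [set w | F i (V1 ^~ w)]).
    exact: bigcup_measurable.
  have mU2 : measurable (\bigcup_i [set w | F i (V2 ^~ w)]).
    exact: bigcup_measurable.
  have tF1 : trivIset setT (fun n => [set w | F n (V1 ^~ w)]).
    by move=> i j _ _ [w ?]; apply: tF => //; exists (V1 ^~ w).
  have tF2 : trivIset setT (fun n => [set w | F n (V2 ^~ w)]).
    by move=> i j _ _ [w ?]; apply: tF => //; exists (V2 ^~ w).
  split; [exact: mU1 | exact: mU2 |].
  apply: (eq_trans (measure_semi_bigcup P1 mF1 tF1 mU1)).
  apply: (eq_trans _ (esym (measure_semi_bigcup P2 mF2 tF2 mU2))).
  by apply: eq_eseriesr => i _; have [] := mF i.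
Qed.

End law_determined_by_fdd.

(** * Riemann sums of right-continuous functions *)

Definition riemann_sum (R : realType) (f : R -> R) (t : R) n : R :=
  \sum_(k < n.+1) f (k.+1%:R * (t / n.+1%:R)) * (t / n.+1%:R).

(** The integrand of a Riemann sum: on each of n cells of length h, the value
    of f at the right end of the cell. *)
Definition right_step (R : realType) (f : R -> R) (h : R) n (s : R) : R :=
  \sum_(k < n) f (k.+1%:R * h) * \1_(`[k%:R * h, k.+1%:R * h[%classic) s.

(** The cell of s has number floor (s / h), so f is evaluated at a point that
    lies to the right of s at distance at most h. *)
Lemma right_stepE (R : realType) (f : R -> R) (h : R) n s :
  0 < h -> 0 <= s < n%:R * h ->
  right_step f h n s = f ((Num.truncn (s / h)).+1%:R * h).
Proof.
move=> h0 /andP[s0 sn].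
have inI k : (s \in `[k%:R * h, k.+1%:R * h[%classic) =
    (Num.truncn (s / h) == k).
  rewrite truncn_eq; last by rewrite divr_ge0// ltW.
  by rewrite mem_setE in_itv /= ler_pdivlMr// ltr_pdivrMr.
have Kn : (Num.truncn (s / h) < n)%N.
  by rewrite truncn_lt_nat ?divr_ge0 ?(ltW h0)// ltr_pdivrMr.
rewrite /right_step (bigD1 (Ordinal Kn))//= indicE inI eqxx mulr1.
rewrite big1 ?addr0// => k kK; rewrite indicE inI eq_sym.
by move: kK; rewrite -val_eqE /= => /negbTE ->; rewrite mulr0.
Qed.

Lemma integral_right_step (R : realType) (f : R -> R) (t : R) n : 0 <= t ->
  (\int[lebesgue_measure]_(s in `[0%R, t[)
     (right_step f (t / n.+1%:R) n.+1 s)%:E = (riemann_sum f t n)%:E)%E.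
Proof.
move=> t0; set h := t / n.+1%:R.
have h0 : 0 <= h by rewrite divr_ge0.
have nh : n.+1%:R * h = t by rewrite mulrC divfK.
have mD : measurable (`[0, t[%classic : set R) by [].
have iI k : (@lebesgue_measure R).-integrable `[0, t[
    (fun s => (\1_(`[k%:R * h, k.+1%:R * h[%classic) s)%:E).
  apply: (@integrableS _ _ _ _ setT) => //.
  exact: (integrable_indic_itv (k%:R * h) (k.+1%:R * h) true true).
under eq_integral.
  move=> s _; rewrite /right_step -sumEFin.
  under eq_bigr do rewrite EFinM.
  over.
rewrite integral_sum//=; last by move=> k; exact: integrableZl.
rewrite /riemann_sum -sumEFin; apply: eq_bigr => k _.
rewrite integralZl// integral_indic// EFinM; congr (_ * _)%E.
rewrite (_ : _ `&` _ = `[k%:R * h, k.+1%:R * h[%classic); last first.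
  apply/setIidl => s /=; rewrite !in_itv /= => /andP[ks sk].
  rewrite (le_trans _ ks) ?mulr_ge0//= (lt_le_trans sk)// -nh.
  by rewrite ler_wpM2r// ler_nat.
apply: (eq_trans (lebesgue_measure_itv `[k%:R * h, k.+1%:R * h[)).
rewrite /= lte_fin.
have khE : k.+1%:R * h - k%:R * h = h by rewrite -natr1; ring.
case: ltP => [_|]; first by rewrite -EFinB khE.
rewrite -subr_le0 khE => h0'.
by congr EFin; apply/eqP; rewrite eq_le h0.
Qed.

(** Right ends are used because f is continuous from the right only: the step
    functions then converge pointwise to f, and they are bounded by M, so
    dominated convergence applies. *)
Lemma riemann_sum_cvg (R : realType) (f : R -> R) (M t : R) : 0 <= t ->
  (forall s, `|f s| <= M) ->
  (forall s, 0 <= s -> f u @[u --> s^'+] --> f s) ->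
  riemann_sum f t @ \oo --> (\int[lebesgue_measure]_(s in `[0, t]) f s : R).
Proof.
move=> t0 fM fc.
pose F n s := right_step f (t / n.+1%:R) n.+1 s.
have Fs n s : `[0, t[%classic s ->
    F n s = f ((Num.truncn (s / (t / n.+1%:R))).+1%:R * (t / n.+1%:R)).
  rewrite /= in_itv /= => /andP[s0 st].
  apply: right_stepE; first by rewrite divr_gt0// (le_lt_trans s0).
  by rewrite s0 mulrC divfK.
have mF n : measurable_fun `[0, t[ (F n).
  by apply: measurable_sum => k; apply: measurable_funM => //.
have Fcvg s : `[0, t[%classic s -> F ^~ s @ \oo --> f s.
  move=> st; have := st; rewrite /= in_itv /= => /andP[s0 s_t].
  have tgt0 : 0 < t by exact: le_lt_trans s_t.
  apply/cvgrPdist_lt => e e0.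
  have /cvgrPdist_lt /(_ e e0) := fc s s0.
  move=> [d /= d0 near_f].
  have : (fun n => t * harmonic n) @ \oo --> (t * 0 : R).
    by apply: cvgMr; exact: cvg_harmonic.
  rewrite mulr0 => /cvgrPdist_lt /(_ d d0); apply: filterS => n /=.
  rewrite sub0r normrN Fs//; set h := t / n.+1%:R.
  move=> hd.
  have h0 : 0 < h by rewrite divr_gt0.
  have /truncn_itv/andP[] : 0 <= s / h by rewrite divr_ge0// ltW.
  rewrite ler_pdivlMr// ltr_pdivrMr//; set x := _.+1%:R * h => lx sx.
  apply: near_f => //=; rewrite distrC ger0_norm ?subr_ge0 ?(ltW sx)//.
  apply: le_lt_trans hd; rewrite (ger0_norm (ltW h0)) lerBlDl.
  by rewrite /x -natr1 mulrDl mul1r lerD2r.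
have mf : measurable_fun `[0, t[ f by exact: measurable_fun_cvg mF Fcvg.
have mD : measurable (`[0, t[%classic : set R) by [].
have iM : (@lebesgue_measure R).-integrable `[0, t[ (EFin \o cst M).
  apply/integrableP; split; first exact/measurable_EFinP.
  rewrite /= integral_cst//.
  rewrite [X in (_ * X < _)%E](lebesgue_measure_itv `[0, t[) /= lte_fin.
  by case: ifP => _; rewrite -?EFinB -?EFinM ?mule0 ltry.
have aeF : {ae (@lebesgue_measure R), forall s, `[0, t[%classic s ->
    (fun n => (EFin \o F n) s) @ \oo --> (EFin \o f) s}.
  by apply: aeW => s st; apply: cvg_EFin; [exact: nearW | exact: Fcvg].
have aeM : {ae (@lebesgue_measure R), forall s n, `[0, t[%classic s ->
    (`|(EFin \o F n) s| <= (EFin \o cst M) s)%E}.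
  by apply: aeW => s n st; rewrite /= lee_fin Fs.
have [int_f _ cvg_int] := @dominated_convergence _ _ R (@lebesgue_measure R) _
  mD (fun n => EFin \o F n) (EFin \o f) (EFin \o cst M)
  (fun n => (measurable_EFinP _ _).2 (mF n)) ((measurable_EFinP _ _).2 mf)
  aeF iM aeM.
move: cvg_int; under eq_fun do rewrite integral_right_step//.
rewrite -[X in _ --> X -> _]fineK; last exact: integrable_fin_num int_f.
move=> /fine_cvg; rewrite /Rintegral -integral_itv_bndo_bndc//.
exact/measurable_EFinP.
Qed.

(** * The position as a functional of the directions *)

HB.instance Definition _ n := isPointed.Build 'I_n.+1 ord0.

Section path_functional.
Context (R : realType) (T : pointedType).

(** The integral of h along the path up to time t, as an upper limit of
    Riemann sums: each sum reads the path at finitely many times, which makes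
    the functional measurable on the space of all paths. *)
Definition integral_functional (h : T -> R) (t : R) (v : R -> T) : R :=
  fine (limn_esup (fun n => (riemann_sum (fun s => h (v s)) t n)%:E)).

Lemma integral_functionalE (h : T -> R) (M t : R) (v : R -> T) : 0 <= t ->
  (forall x, `|h x| <= M) ->
  (forall s, 0 <= s -> \forall u \near s^'+, v u = v s) ->
  integral_functional h t v = \int[lebesgue_measure]_(s in `[0, t]) h (v s).
Proof.
move=> t0 hM vr.
have cv : (fun n => (riemann_sum (fun s => h (v s)) t n)%:E) @ \oo -->
    (\int[lebesgue_measure]_(s in `[0, t]) h (v s))%:E.
  apply: cvg_EFin; first exact: nearW.
  apply: (riemann_sum_cvg t0 (M := M)) => // s s0.
  by apply: cvg_near_cst; apply: filterS (vr s s0) => u /= ->.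
rewrite /integral_functional is_cvg_limn_esupE; first by rewrite (cvg_lim _ cv).
by apply/cvg_ex; eexists; exact: cv.
Qed.

Lemma measurable_integral_functional (h : T -> R) (t : R) : 0 <= t ->
  measurable_fun setT
    (integral_functional h t :
       g_sigma_algebraType (@finite_time_event R T) -> R).
Proof.
move=> t0; apply: (measurableT_comp (f := fine)); first exact: fine_measurable.
apply: measurable_fun_limn_esup => n; apply/measurable_EFinP.
apply: measurable_sum => k; apply: measurable_funM => // _ Y mY.
rewrite setTI; apply: sub_sigma_algebra.
apply: (finite_time_event_coordinate (h @^-1` Y)).
by rewrite mulr_ge0// divr_ge0.
Qed.

End path_functional.

Definition motion_functional (R : realType) (c : R) (v : R -> 'I_4) (t : R) :
    R * R :=
  (integral_functional (fun k => c * (direction R k).1) t v,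
   integral_functional (fun k => c * (direction R k).2) t v).

(** The count is right-continuous with values in nat, so the current direction
    is constant just after any time and its Riemann sums converge. *)
Lemma orthogonal_motionE d (W : measurableType d) (R : realType)
    (P : probability W R) (c : R) (rate : R -> R) (XY : R -> W -> R * R)
    (N : R -> W -> nat) (D : nat -> W -> 'I_4) :
  poisson_process P rate N ->
  (forall (t : R) w, 0 <= t ->
     XY t w =
     (\int[lebesgue_measure]_(s in `[0, t])
        (c * (direction R (D (N s w) w)).1),
      \int[lebesgue_measure]_(s in `[0, t])
        (c * (direction R (D (N s w) w)).2))) ->
  forall t w, 0 <= t -> XY t w = motion_functional c (fun s => D (N s w) w) t.
Proof.
move=> HN HXY t w t0; rewrite HXY// /motion_functional.
have bounded (h : 'I_4 -> R) k : `|h k| <= \sum_(j < 4) `|h j|.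
  by rewrite (bigD1 k)//= lerDl sumr_ge0.
have right_cst s : 0 <= s -> \forall u \near s^'+, D (N u w) w = D (N s w) w.
  by move=> s0; apply: filterS (poisson_right_cont HN w s0) => u ->.
by rewrite !(integral_functionalE t0 (bounded _) right_cst).
Qed.

(** An event about positions is an event about directions.  The functional
    agrees with the motion at times t >= 0 only; the second part allows to
    exchange them inside A. *)
Lemma motion_functional_event (R : realType) (c : R) (A : set (R -> R * R)) :
  process_sigma [set t : R | 0 <= t]
      (measurable : set (set (measurableTypeR R * measurableTypeR R)))
      (fun t (path : R -> R * R) => path t) A ->
  <<s @finite_time_event R 'I_4 >> (motion_functional c @^-1` A) /\
  (forall p p', (forall t, 0 <= t -> p t = p' t) -> A p <-> A p').
Proof.
have [s0 sC sU] := @smallest_sigma_algebra _ setT (@finite_time_event R 'I_4).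
move: A; apply: smallest_sub => [|A [t t0 [B mB <-]]].
  split.
  - by split.
  - move=> A [sA extA]; split; first exact: (sC _ sA).
    by move=> p p' pp'; split=> -[_ nA]; split => // /(extA _ _ pp').
  - move=> F sF; split; first by apply: sU => n; have [] := sF n.
    move=> p p' pp'; split=> -[n _ Fn]; exists n => //; have [_ extF] := sF n;
      exact/(extF _ _ pp').
split; last first.
  by move=> p p' pp'; rewrite /preimage /= pp'.
have mfun : measurable_fun setT ((fun v => motion_functional c v t) :
    g_sigma_algebraType (@finite_time_event R 'I_4) ->
    measurableTypeR R * measurableTypeR R).
  by apply: measurable_fun_pair; exact: measurable_integral_functional.
by have := mfun measurableT B mB; rewrite !setTI.
Qed.

(** The law of an orthogonal motion with symmetric directions depends on the
    eigenvalue a of its kernel and on its rate only through the integrals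
    of rate * (a - 1), the exponents at which its directions decorrelate. *)
Lemma orthogonal_motion_law d1 (W1 : measurableType d1) d2
    (W2 : measurableType d2) (R : realType)
    (P1 : probability W1 R) (P2 : probability W2 R) (c a1 a2 : R)
    (rate1 rate2 : R -> R) (XY1 : R -> W1 -> R * R) (XY2 : R -> W2 -> R * R) :
  (forall t, 0 < t -> 0 <= rate1 t) -> (forall t, 0 < t -> 0 <= rate2 t) ->
  orthogonal_motion P1 (symmetric_kernel a1) c rate1 XY1 ->
  orthogonal_motion P2 (symmetric_kernel a2) c rate2 XY2 ->
  (forall s t : R, 0 <= s -> s <= t ->
    (\int[lebesgue_measure]_(u in `]s, t]) rate1 u) * (a1 - 1) =
    (\int[lebesgue_measure]_(u in `]s, t]) rate2 u) * (a2 - 1)) ->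
  equal_in_distribution P1 P2 XY1 XY2.
Proof.
move=> rate1_ge0 rate2_ge0 [N1 [D1 [HN1 HD1 HI1 HXY1]]].
move=> [N2 [D2 [HN2 HD2 HI2 HXY2]]] rateE A.
move=> /(motion_functional_event c)[sA extA].
have E1 : [set w | A (XY1 ^~ w)] =
    [set w | (motion_functional c @^-1` A) (fun s => D1 (N1 s w) w)].
  by apply/seteqP; split => w; apply: (extA _ _ _).1 => t t0;
    rewrite (orthogonal_motionE HN1 HXY1).
have E2 : [set w | A (XY2 ^~ w)] =
    [set w | (motion_functional c @^-1` A) (fun s => D2 (N2 s w) w)].
  by apply/seteqP; split => w; apply: (extA _ _ _).1 => t t0;
    rewrite (orthogonal_motionE HN2 HXY2).
rewrite E1 E2.
have [] // := sigma_finite_time_event_same_law (P1 := P1) (P2 := P2)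
  (V1 := fun t w => D1 (N1 t w) w) (V2 := fun t w => D2 (N2 t w) w) _ _ _ sA.
- by move=> t t0; exact: (current_direction_discrete HN1 HD1).
- by move=> t t0; exact: (current_direction_discrete HN2 HD2).
- move=> t k m t0 tS; elim: m => [|m IH].
    by rewrite (direction_initial HN1 HD1 t0) (direction_initial HN2 HD2 t0).
  rewrite (direction_markov rate1_ge0 HN1 HD1 HI1 t0 tS).
  rewrite (direction_markov rate2_ge0 HN2 HD2 HI2 t0 tS) IH rateE//.
  exact: times_ge0.
Qed.

Unset Implicit Arguments.

Theorem theorem3p3 (R : realType) (q c : R) (lambda : R -> R)
    (hq0 : 0 < q) (hq1 : q <= 1) (hc : 0 < c)
    (hlambda0 : forall t : R, 0 < t -> 0 <= lambda t)
    (hlambda : C2_on_pos lambda)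
    (d1 : measure_display) (W1 : measurableType d1) (P1 : probability W1 R)
    (XYq : R -> W1 -> R * R)
    (hXYq : q_reflecting_motion P1 q c lambda XYq)
    (d2 : measure_display) (W2 : measurableType d2) (P2 : probability W2 R)
    (XY : R -> W2 -> R * R)
    (hXY : reflecting_motion P2 c (fun t => q * lambda t) XY) :
  equal_in_distribution P1 P2 XYq XY.
Proof.
have int_lambda t : 0 <= t ->
    lebesgue_measure.-integrable `]0, t] (EFin \o lambda).
  by move: hXYq => [N [D [HN _ _ _]]]; exact: (poisson_rate_integrable HN).
have Kq : @q_reflecting_kernel R q = symmetric_kernel (1 - 4 / 3 * q).
  by apply/funext => i; apply/funext => j; rewrite q_reflecting_kernelE.
have K1 : @reflecting_kernel R = symmetric_kernel (1 - 4 / 3 * 1).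
  apply/funext => i; apply/funext => j; rewrite -q_reflecting_kernelE.
  by rewrite /reflecting_kernel /q_reflecting_kernel subrr mul1r.
move: hXYq hXY; rewrite /q_reflecting_motion /reflecting_motion Kq K1.
move=> hXYq hXY.
apply: (orthogonal_motion_law _ _ hXYq hXY) => //.
  by move=> t t0; rewrite mulr_ge0 ?(ltW hq0)//; exact: hlambda0.
move=> s t s0 st; rewrite RintegralZl//; first by ring.
apply: integrableS (int_lambda t (le_trans s0 st)) => //.
by move=> u /=; rewrite !in_itv /= => /andP[su ->]; rewrite (le_lt_trans s0).
Qed.
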